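(* Let $a$ be a complex number not equal to a non-zero integer. Then $$\sum_{k=1}^{\infty}\frac{1}{k^2-a^2}=\sum_{n=1}^{\infty}\frac{n^2(21n-8)-a^2(9n-2)}{\binom{2n}{n}\,n\,(n^2-a^2)(4n^2-a^2)}\prod_{k=1}^{n-1}\left(\frac{k^2-4a^2}{(k+n)^2-a^2}\right).$$
   Context: An empty product (the case $n=1$) equals $1$. *)

(* Defs.v *)
From Stdlib Require Import Reals ZArith.
From Coquelicot Require Import Coquelicot.

Definition natC (n : nat) : C := RtoC (INR n).

(** [prodC f m n] is the product of [f k] for [m <= k <= n], both ends included;
    it is the empty product [1] when [n < m].  *)
Definition prodC (f : nat -> C) (m n : nat) : C :=
  Iter.iter_nat Cmult (RtoC 1) f m n.

(** [is_series1 u s] : the series [u 1 + u 2 + u 3 + ...] converges to [s];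
    Coquelicot's [is_series] starts at index [0]. *)
Definition is_series1 (u : nat -> C) (s : C) : Prop :=
  is_series (fun n => u (S n)) s.

(** For [n = 1] the upper bound [n - 1] of the product is [0], so the product
    is empty. *)
Definition accelerated_term (a : C) (n : nat) : C :=
  ((natC n ^ 2 * (21 * natC n - 8) - a ^ 2 * (9 * natC n - 2))
   / (RtoC (Binomial.C (2 * n) n) * natC n
      * (natC n ^ 2 - a ^ 2) * (4 * natC n ^ 2 - a ^ 2))
   * prodC (fun k => (natC k ^ 2 - 4 * a ^ 2) / ((natC k + natC n) ^ 2 - a ^ 2))
           1 (n - 1))%C.

(* Main.v *)
Require Import Defs.
From Stdlib Require Import Reals ZArith.
From Coquelicot Require Import Coquelicot.
From Stdlib Require Import Lra Lia.

(** WZ method. Put [D m = m^2 - a^2] and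
    [F n k = prod_(1 <= j <= n) (j^2 - 4 a^2) / (C(2n, n) prod_(n+k <= j <= 2n+k) D j)],
    so that [F 0 k = 1 / (k^2 - a^2)]. There is a polynomial [Q] such that
    [G n k = F n k * Q n k / (2 (2n+1) D (2n+k+1))] satisfies
    [F n k - F (n+1) k = G n k - G n (k+1)]. Since [G n k] tends to [0] as [k] grows,
    summing over [k >= 1] shows that the sums [S n] of [F n k] over [k >= 1] obey
    [S n - S (n+1) = G n 1], and [G n 1] is the [(n+1)]-st accelerated term.
    Finally [S n] tends to [0], because [|F (n+1) k| <= |F n k| / 2] for all large [n],
    uniformly in [k]. *)

(** * Finite products over index ranges *)

Lemma prodC_last (f : nat -> C) (m n : nat) :
  (m <= S n)%nat -> prodC f m (S n) = (prodC f m n * f (S n))%C.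
Proof.
  intros Hm; unfold prodC.
  rewrite (Iter.iter_nat_Chasles _ _ Cmult_1_l Cmult_assoc f m n (S n)); [| lia ..].
  now rewrite (Iter.iter_nat_point Cmult (RtoC 1) Cmult_1_r f (S n)).
Qed.

Lemma prodC_first (f : nat -> C) (m n : nat) :
  (m <= n)%nat -> prodC f m n = (f m * prodC f (S m) n)%C.
Proof.
  intros Hm; unfold prodC.
  rewrite (Iter.iter_nat_Chasles _ _ Cmult_1_l Cmult_assoc f m m n); [| lia ..].
  now rewrite (Iter.iter_nat_point Cmult (RtoC 1) Cmult_1_r f m).
Qed.

Lemma prodC_neq_0 (f : nat -> C) (m n : nat) :
  (forall k, (m <= k)%nat -> f k <> RtoC 0) -> prodC f m n <> RtoC 0.
Proof.
  intros Hf; induction n as [| n IHn].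
  - destruct m as [| m]; unfold prodC, Iter.iter_nat; simpl.
    + rewrite Cmult_1_r; apply Hf; lia.
    + exact C1_nz.
  - destruct (Nat.le_gt_cases m (S n)) as [Hm | Hm].
    + rewrite prodC_last by exact Hm.
      apply Cmult_neq_0; [exact IHn | now apply Hf].
    + unfold prodC, Iter.iter_nat.
      replace (S (S n) - m)%nat with 0%nat by lia; exact C1_nz.
Qed.

(** Brings the product in [accelerated_term] to the shape of [wz_F]: the shifted denominators,
    reindexed, run over consecutive indices from [S p] to [n + p]. *)
Lemma prodC_div_shift (f g : nat -> C) (n p : nat) :
  (forall k, (S p <= k)%nat -> g k <> RtoC 0) ->
  prodC (fun k => f k / g (k + p)%nat)%C 1 n
  = (prodC f 1 n / prodC g (S p) (n + p))%C.
Proof.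
  intros Hg; induction n as [| n IHn].
  - unfold prodC, Iter.iter_nat.
    replace (S (0 + p) - S p)%nat with 0%nat by lia; simpl.
    symmetry; apply Cinv_r, C1_nz.
  - change (S n + p)%nat with (S (n + p)).
    rewrite !prodC_last, IHn by lia.
    change (S n + p)%nat with (S (n + p)).
    field; split; [apply Hg; lia | now apply prodC_neq_0].
Qed.

(** * Central binomial coefficients and non-vanishing factors *)

Lemma central_binomial_S (n : nat) :
  (Binomial.C (2 * S n) (S n) * INR (S n)
   = 2 * (2 * INR n + 1) * Binomial.C (2 * n) n)%R.
Proof.
  unfold Binomial.C.
  replace (2 * S n - S n)%nat with (S n) by lia.
  replace (2 * n - n)%nat with n by lia.
  replace (2 * S n)%nat with (S (S (2 * n))) by lia.
  rewrite !fact_simpl, !mult_INR, !S_INR, mult_INR; simpl (INR 2).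
  pose proof (INR_fact_neq_0 n); pose proof (pos_INR n).
  field; lra.
Qed.

Lemma binomial_neq_0 (n k : nat) : Binomial.C n k <> 0%R.
Proof.
  unfold Binomial.C, Rdiv.
  apply Rmult_integral_contrapositive_currified; [apply INR_fact_neq_0 |].
  apply Rinv_neq_0_compat, Rmult_integral_contrapositive_currified;
    apply INR_fact_neq_0.
Qed.

Lemma natC_S (n : nat) : natC (S n) = (natC n + 1)%C.
Proof. unfold natC; now rewrite S_INR, RtoC_plus. Qed.

Lemma natC_plus (m n : nat) : natC (m + n) = (natC m + natC n)%C.
Proof. unfold natC; now rewrite plus_INR, RtoC_plus. Qed.

Lemma odd_natC_neq_0 (n : nat) : (2 * natC n + 1)%C <> RtoC 0.
Proof.
  unfold natC; rewrite <- RtoC_mult, <- RtoC_plus; intros H.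
  apply RtoC_inj in H; pose proof (pos_INR n); lra.
Qed.

Lemma natC_S_neq_0 (n : nat) : (natC n + 1)%C <> RtoC 0.
Proof.
  rewrite <- natC_S; unfold natC; intros H.
  apply RtoC_inj in H; revert H; now apply not_0_INR.
Qed.

Lemma RtoC_2_neq_0 : RtoC 2 <> RtoC 0.
Proof. intros H; apply RtoC_inj in H; lra. Qed.

Lemma RtoC_binomial_neq_0 (n k : nat) : RtoC (Binomial.C n k) <> RtoC 0.
Proof. intros H; apply RtoC_inj in H; now apply (binomial_neq_0 n k). Qed.

Lemma RtoC_central_binomial_S (n : nat) :
  (RtoC (Binomial.C (2 * S n) (S n))
   = 2 * (2 * natC n + 1) * RtoC (Binomial.C (2 * n) n) / (natC n + 1))%C.
Proof.
  transitivity (RtoC (Binomial.C (2 * S n) (S n)) * natC (S n) / (natC n + 1))%C.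
  - rewrite natC_S; field; apply natC_S_neq_0.
  - unfold natC at 1.
    rewrite <- RtoC_mult, central_binomial_S, !RtoC_mult, RtoC_plus, RtoC_mult.
    reflexivity.
Qed.

(** * Limits and series *)

Lemma sq_INR_eventually_ge (x : R) : exists N : nat, forall n, (N <= n)%nat -> (x <= INR n ^ 2)%R.
Proof.
  destruct (INR_unbounded (Rmax 1 x)) as [N HN]; exists N; intros n Hn.
  apply le_INR in Hn.
  pose proof (Rmax_l 1 x); pose proof (Rmax_r 1 x); nra.
Qed.

(** The partial sum up to [n] collapses to [u 0 - u (S n)], whose second term tends to zero. *)
Lemma is_series_telescope {K : AbsRing} {V : NormedModule K} (u : nat -> V) :
  filterlim u eventually (locally (zero : V)) ->
  is_series (fun k => minus (u k) (u (S k))) (u 0%nat).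
Proof.
  intros Hu.
  assert (Hsum : forall n,
    sum_n (fun k => minus (u k) (u (S k))) n = minus (u 0%nat) (u (S n))).
  { intros n; induction n as [| n IHn].
    - now rewrite sum_O.
    - rewrite sum_Sn, IHn; symmetry; apply minus_trans. }
  unfold is_series.
  apply (filterlim_ext (fun n => minus (u 0%nat) (u (S n)))).
  { intros n; symmetry; apply Hsum. }
  replace (locally (u 0%nat)) with (locally (minus (u 0%nat) zero))
    by now rewrite minus_zero_r.
  apply (filterlim_comp_2 (G := locally (u 0%nat)) (H := locally (opp (zero : V)))
    (fun _ => u 0%nat) (fun n => opp (u (S n))) plus).
  - apply filterlim_const.
  - apply (filterlim_comp _ _ _ (fun n => u (S n)) opp _ (locally (zero : V))).
    + apply (filterlim_comp _ _ _ S u _ eventually); [apply eventually_subseq; auto | exact Hu].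
    + apply filterlim_opp.
  - apply filterlim_plus.
Qed.

(** The triangle inequality gives the bound for partial sums, and continuity of the norm carries it
    to the limit. *)
Lemma norm_series_le {K : AbsRing} {V : NormedModule K}
    (u : nat -> V) (b : nat -> R) (s : V) (t : R) :
  is_series u s -> is_series b t -> (forall k, (norm (u k) <= b k)%R) ->
  (norm s <= t)%R.
Proof.
  intros Hu Hb Hle.
  apply (filterlim_le (F := eventually) (fun n => norm (sum_n u n)) (sum_n b)
    (Finite (norm s)) (Finite t)).
  - exists 0%nat; intros n _; induction n as [| n IHn].
    + rewrite !sum_O; apply Hle.
    + rewrite !sum_Sn.
      eapply Rle_trans; [apply norm_triangle |].
      now apply Rplus_le_compat.
  - exact (filterlim_comp _ _ _ _ norm _ _ _ Hu (filterlim_norm s)).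
  - exact Hb.
Qed.

Lemma is_lim_seq_div_INR (c : R) : is_lim_seq (fun k => c / INR (S k))%R 0.
Proof.
  evar_last; [apply is_lim_seq_scal_l |].
  - apply (is_lim_seq_incr_1 (fun k => / INR k)%R).
    apply (is_lim_seq_inv _ p_infty); [apply is_lim_seq_INR | easy].
  - simpl; f_equal; ring.
Qed.

(* The summand is [B / (k+1) - B / (k+2)], so the series telescopes. *)
Lemma is_series_inv_pronic (B : R) :
  is_series (fun k => B / (INR (S k) * (INR (S k) + 1)))%R B.
Proof.
  pose proof (is_series_telescope (V := R_NormedModule)
    (fun k => B / INR (S k))%R (is_lim_seq_div_INR B)) as H.
  cbv beta in H; rewrite INR_1, Rdiv_1_r in H.
  refine (is_series_ext _ _ _ _ H); intros k.
  change (B / INR (S k) - B / INR (S (S k))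
    = B / (INR (S k) * (INR (S k) + 1)))%R.
  rewrite (S_INR (S k)).
  assert (0 < INR (S k))%R by (apply lt_0_INR; lia).
  field; lra.
Qed.

(** * The WZ functions *)

Definition sqdiff (a : C) (m : nat) : C := (natC m ^ 2 - a ^ 2)%C.

Definition numer (a : C) (n : nat) : C :=
  prodC (fun k => natC k ^ 2 - 4 * a ^ 2)%C 1 n.

Definition wz_F (a : C) (n k : nat) : C :=
  (numer a n
   / (RtoC (Binomial.C (2 * n) n) * prodC (sqdiff a) (n + k) (2 * n + k)))%C.

(* Found by solving the linear system that [wz_pair] imposes on the coefficients;
   only its degree 3 in [k] matters for the estimates. *)
Definition wz_Q (a : C) (n k : nat) : C :=
  (21 * natC n ^ 3 + 27 * natC n ^ 2 + 12 * natC n + 2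
   + natC k * (28 * natC n ^ 2 + 22 * natC n + 4)
   + natC k ^ 2 * (13 * natC n + 5) + 2 * natC k ^ 3
   - a ^ 2 * (9 * natC n + 5 + 2 * natC k))%C.

Definition wz_G (a : C) (n k : nat) : C :=
  (wz_F a n k * wz_Q a n k
   / (2 * (2 * natC n + 1) * sqdiff a (S (2 * n + k))))%C.

(** The quotient of [wz_F a (S n) k] by [wz_F a n k]. As [n] grows by one, the index range of the
    denominator loses its first factor and gains two at the end; the part free of [k] comes from
    [numer] and the binomial coefficient. *)
Definition wz_ratio (a : C) (n k : nat) : C :=
  ((natC n + 1) * ((natC n + 1) ^ 2 - 4 * a ^ 2) / (2 * (2 * natC n + 1))
   * sqdiff a (n + k)
   / (sqdiff a (S (2 * n + k)) * sqdiff a (S (S (2 * n + k)))))%C.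

(** * Algebraic identities of the WZ pair *)

Section NonIntegral.

Variable a : C.
Hypothesis ha : forall m : Z, m <> 0%Z -> a <> RtoC (IZR m).

(** In the factorisation [(m - a) (m + a)] the hypothesis on [a] applies to [m] and to [-m]. Index
    [0] is excluded because [a = 0] is allowed. *)
Lemma sqdiff_neq_0 (m : nat) : (1 <= m)%nat -> sqdiff a m <> RtoC 0.
Proof.
  intros Hm.
  replace (sqdiff a m) with ((natC m - a) * (natC m + a))%C by (unfold sqdiff; ring).
  unfold natC; rewrite INR_IZR_INZ.
  apply Cmult_neq_0; intros H.
  - apply (ha (Z.of_nat m)); [lia |].
    symmetry; now apply Ceq_minus.
  - apply (ha (- Z.of_nat m)%Z); [lia |].
    rewrite opp_IZR, RtoC_opp.
    transitivity (RtoC (IZR (Z.of_nat m)) + a - RtoC (IZR (Z.of_nat m)))%C; [ring |].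
    rewrite H; ring.
Qed.

Lemma prod_sqdiff_neq_0 (m n : nat) :
  (1 <= m)%nat -> prodC (sqdiff a) m n <> RtoC 0.
Proof. intros Hm; apply prodC_neq_0; intros k Hk; apply sqdiff_neq_0; lia. Qed.

Lemma wz_F_ratio (n k : nat) :
  (1 <= k)%nat -> wz_F a (S n) k = (wz_F a n k * wz_ratio a n k)%C.
Proof.
  intros Hk.
  (* Both sides are the product over all indices from [n + k] to [2n + k + 2]. *)
  assert (HP : (sqdiff a (n + k) * prodC (sqdiff a) (S n + k) (2 * S n + k)
    = prodC (sqdiff a) (n + k) (2 * n + k)
      * sqdiff a (S (2 * n + k)) * sqdiff a (S (S (2 * n + k))))%C).
  { rewrite <- !prodC_last by lia.
    replace (2 * S n + k)%nat with (S (S (2 * n + k))) by lia.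
    symmetry; apply prodC_first; lia. }
  unfold wz_F, wz_ratio, numer.
  rewrite prodC_last, natC_S, RtoC_central_binomial_S by lia.
  replace (prodC (sqdiff a) (S n + k) (2 * S n + k)) with
    (prodC (sqdiff a) (n + k) (2 * n + k)
      * sqdiff a (S (2 * n + k)) * sqdiff a (S (S (2 * n + k)))
      / sqdiff a (n + k))%C.
  2:{ rewrite <- HP; field; apply sqdiff_neq_0; lia. }
  field.
  repeat split; try (apply sqdiff_neq_0; lia);
    try (apply prod_sqdiff_neq_0; lia);
    first [apply RtoC_binomial_neq_0 | apply odd_natC_neq_0 | apply natC_S_neq_0
          | apply RtoC_2_neq_0].
Qed.

Lemma wz_F_step (n k : nat) :
  (1 <= k)%nat ->
  wz_F a n (S k) = (wz_F a n k * sqdiff a (n + k) / sqdiff a (S (2 * n + k)))%C.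
Proof.
  intros Hk.
  assert (HP : (sqdiff a (n + k) * prodC (sqdiff a) (n + S k) (2 * n + S k)
    = prodC (sqdiff a) (n + k) (2 * n + k) * sqdiff a (S (2 * n + k)))%C).
  { rewrite <- prodC_last by lia.
    rewrite !Nat.add_succ_r.
    symmetry; apply prodC_first; lia. }
  unfold wz_F.
  replace (prodC (sqdiff a) (n + S k) (2 * n + S k)) with
    (prodC (sqdiff a) (n + k) (2 * n + k) * sqdiff a (S (2 * n + k))
      / sqdiff a (n + k))%C.
  2:{ rewrite <- HP; field; apply sqdiff_neq_0; lia. }
  field.
  repeat split; try (apply sqdiff_neq_0; lia);
    try (apply prod_sqdiff_neq_0; lia); apply RtoC_binomial_neq_0.
Qed.

(** All four terms are rational multiples of [wz_F a n k], so the claim reduces to an identity of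
    rational functions in [n], [k] and [a]. *)
Lemma wz_pair (n k : nat) :
  (1 <= k)%nat ->
  (wz_F a n k - wz_F a (S n) k = wz_G a n k - wz_G a n (S k))%C.
Proof.
  intros Hk; unfold wz_G.
  rewrite wz_F_ratio, wz_F_step by exact Hk; unfold wz_ratio.
  assert (H1 : sqdiff a (S (2 * n + k)) <> RtoC 0) by (apply sqdiff_neq_0; lia).
  assert (H2 : sqdiff a (S (S (2 * n + k))) <> RtoC 0) by (apply sqdiff_neq_0; lia).
  rewrite Nat.add_succ_r.
  pose proof (odd_natC_neq_0 n) as H3; pose proof RtoC_2_neq_0 as H4.
  unfold sqdiff, wz_Q in *.
  (* Written as a sum, the index is split by [natC_plus] into [natC n] and [natC k]. *)
  replace (2 * n + k)%nat with (n + (n + k))%nat in * by lia.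
  rewrite !natC_S, !natC_plus in *.
  field; repeat split; assumption.
Qed.

(** With [N = n + 1], [wz_Q a n 1] is [N^2 (21 N - 8) - a^2 (9 N - 2)]. The factors [N^2 - a^2] and
    [4 N^2 - a^2] are [sqdiff] at [N] and [2N], and [2 (2n + 1) C(2n, n) = N C(2N, N)]. *)
Lemma wz_G_1 (n : nat) : wz_G a n 1 = accelerated_term a (S n).
Proof.
  unfold accelerated_term.
  rewrite Nat.sub_succ, Nat.sub_0_r.
  replace (prodC _ 1 n) with
    (numer a n / prodC (sqdiff a) (S (S n)) (n + S n))%C.
  2:{ unfold numer; rewrite <- (prodC_div_shift _ (sqdiff a)).
      - unfold prodC; apply Iter.iter_nat_ext_loc; intros k _.
        unfold sqdiff; now rewrite natC_plus.
      - intros k Hk; apply sqdiff_neq_0; lia. }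
  unfold wz_G, wz_F.
  replace (n + 1)%nat with (S n) by lia.
  replace (2 * n + 1)%nat with (n + S n)%nat by lia.
  rewrite (prodC_first _ (S n)), RtoC_central_binomial_S by lia.
  assert (H1 : prodC (sqdiff a) (S (S n)) (n + S n) <> RtoC 0)
    by (apply prod_sqdiff_neq_0; lia).
  assert (H2 : sqdiff a (S n) <> RtoC 0) by (apply sqdiff_neq_0; lia).
  assert (H3 : sqdiff a (S (n + S n)) <> RtoC 0) by (apply sqdiff_neq_0; lia).
  pose proof (odd_natC_neq_0 n) as H4; pose proof RtoC_2_neq_0 as H5.
  pose proof (natC_S_neq_0 n) as H6.
  pose proof (RtoC_binomial_neq_0 (2 * n) n) as H7.
  set (P := prodC (sqdiff a) _ _) in *.
  unfold sqdiff, wz_Q in *.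
  rewrite !natC_S, !natC_plus, !natC_S in *.
  change (natC 0) with (RtoC 0).
  field; repeat split; try assumption.
  (* The remaining side condition is [H3] up to a ring rearrangement. *)
  intros H; apply H3; rewrite <- H; ring.
Qed.

(** * Size of [m^2 - a^2] *)

Lemma Cmod_sqdiff_le (m : nat) : (Cmod (sqdiff a m) <= INR m ^ 2 + Cmod a ^ 2)%R.
Proof.
  unfold sqdiff, natC, Cminus.
  eapply Rle_trans; [apply Cmod_triangle |].
  rewrite Cmod_opp, !Cmod_pow, Cmod_R, Rabs_pos_eq by apply pos_INR; lra.
Qed.

Lemma Cmod_sqdiff_ge (m : nat) : (INR m ^ 2 - Cmod a ^ 2 <= Cmod (sqdiff a m))%R.
Proof.
  assert (H : (Cmod (natC m ^ 2) <= Cmod (sqdiff a m) + Cmod (a ^ 2))%R).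
  { eapply Rle_trans; [| apply Cmod_triangle].
    right; f_equal; unfold sqdiff; ring. }
  unfold natC in H.
  rewrite !Cmod_pow, Cmod_R, Rabs_pos_eq in H by apply pos_INR; lra.
Qed.

Lemma Cmod_sqdiff_pos (m : nat) : (1 <= m)%nat -> (0 < Cmod (sqdiff a m))%R.
Proof. intros Hm; now apply Cmod_gt_0, sqdiff_neq_0. Qed.

(** Once [m^2 >= 2 |a|^2], the constant [2] suffices by the reverse triangle inequality. The
    finitely many smaller [m] are covered by enlarging the constant, since [sqdiff a m] is
    non-zero. *)
Lemma sq_le_sqdiff :
  exists M : R, (0 < M)%R /\
    forall m, (1 <= m)%nat -> (INR m ^ 2 <= M * Cmod (sqdiff a m))%R.
Proof.
  assert (Hfin : forall N, exists M : R, (0 < M)%R /\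
    forall m, (1 <= m <= N)%nat -> (INR m ^ 2 <= M * Cmod (sqdiff a m))%R).
  { intros N; induction N as [| N [M [HM IH]]].
    - exists 1%R; split; [lra | intros m Hm; lia].
    - pose proof (Cmod_sqdiff_pos (S N) ltac:(lia)) as Hp.
      assert (Hq : (0 <= INR (S N) ^ 2 / Cmod (sqdiff a (S N)))%R).
      { apply Rdiv_le_0_compat; [apply pow2_ge_0 | exact Hp]. }
      exists (M + INR (S N) ^ 2 / Cmod (sqdiff a (S N)))%R; split; [lra |].
      intros m Hm; destruct (Nat.eq_dec m (S N)) as [-> | Hne].
      + rewrite Rmult_plus_distr_r; unfold Rdiv at 1.
        rewrite Rmult_assoc, Rinv_l by lra; nra.
      + specialize (IH m ltac:(lia)); pose proof (Cmod_ge_0 (sqdiff a m)); nra. }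
  destruct (sq_INR_eventually_ge (2 * Cmod a ^ 2)) as [N HN].
  destruct (Hfin N) as [M [HM IH]].
  exists (M + 2)%R; split; [lra |]; intros m Hm.
  pose proof (Cmod_ge_0 (sqdiff a m)).
  destruct (Nat.le_gt_cases m N) as [Hle | Hgt].
  - specialize (IH m ltac:(lia)); nra.
  - specialize (HN m ltac:(lia)); pose proof (Cmod_sqdiff_ge m); nra.
Qed.

(** * Bounds on [F] and its ratio *)

Lemma wz_F_0 (k : nat) :
  (1 <= k)%nat -> wz_F a 0 k = (1 / sqdiff a k)%C.
Proof.
  intros Hk; unfold wz_F, numer.
  replace (Binomial.C (2 * 0) 0) with 1%R by (unfold Binomial.C; simpl; field).
  replace (prodC _ 1 0) with (RtoC 1) by reflexivity.
  replace (prodC (sqdiff a) (0 + k) (2 * 0 + k)) with (sqdiff a k).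
  - field; now apply sqdiff_neq_0.
  - symmetry; now apply (Iter.iter_nat_point Cmult (RtoC 1) Cmult_1_r).
Qed.

(** A crude bound depending on [n], enough to carry decay in [k] from one [n] to the next. *)
Lemma wz_ratio_bounded (n : nat) :
  exists c : R, (0 <= c)%R /\ forall k, (1 <= k)%nat -> (Cmod (wz_ratio a n k) <= c)%R.
Proof.
  destruct sq_le_sqdiff as [M [HM HMb]].
  unfold wz_ratio; set (rho := ((natC n + 1) * _ / _)%C).
  (* [rho] is the part free of [k]; [1 + |a|^2] comes from the numerator factor, and each
     denominator factor contributes one [M]. *)
  exists (Cmod rho * ((1 + Cmod a ^ 2) * M ^ 2))%R; split.
  { apply Rmult_le_pos; [apply Cmod_ge_0 | apply Rmult_le_pos].
    - pose proof (pow2_ge_0 (Cmod a)); lra.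
    - apply pow2_ge_0. }
  intros k Hk.
  pose proof (Cmod_sqdiff_pos (S (2 * n + k)) ltac:(lia)) as P1.
  pose proof (Cmod_sqdiff_pos (S (S (2 * n + k))) ltac:(lia)) as P2.
  pose proof (HMb (S (2 * n + k)) ltac:(lia)) as B1.
  pose proof (HMb (S (S (2 * n + k))) ltac:(lia)) as B2.
  pose proof (Cmod_sqdiff_le (n + k)) as B0.
  assert (L1 : (1 <= INR (n + k) <= INR (S (2 * n + k)))%R)
    by (split; [apply (le_INR 1) | apply le_INR]; lia).
  assert (L2 : (1 <= INR (S (S (2 * n + k))))%R) by (apply (le_INR 1); lia).
  rewrite Cmod_div, !Cmod_mult
    by (apply Cmult_neq_0; apply sqdiff_neq_0; lia).
  unfold Rdiv; rewrite Rmult_assoc.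
  apply Rmult_le_compat_l; [apply Cmod_ge_0 |].
  apply Rle_div_l; [now apply Rmult_lt_0_compat |].
  set (d1 := Cmod (sqdiff a (S (2 * n + k)))) in *.
  set (d2 := Cmod (sqdiff a (S (S (2 * n + k))))) in *.
  set (x := INR (n + k)) in *; set (y := INR (S (2 * n + k))) in *.
  set (z := INR (S (S (2 * n + k)))) in *.
  pose proof (pow2_ge_0 (Cmod a)) as Ha; set (al := (Cmod a ^ 2)%R) in *.
  assert (X : (1 <= x ^ 2 <= y ^ 2)%R) by nra.
  assert (Z : (1 <= z ^ 2)%R) by nra.
  assert (U0 : (x ^ 2 + al <= (1 + al) * x ^ 2)%R) by nra.
  assert (U3 : (x ^ 2 <= (M * d1) * (M * d2))%R).
  { rewrite <- (Rmult_1_r (x ^ 2)); apply Rmult_le_compat; lra. }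
  replace ((1 + al) * M ^ 2 * (d1 * d2))%R
    with ((1 + al) * ((M * d1) * (M * d2)))%R by ring.
  apply (Rle_trans _ ((1 + al) * x ^ 2)); [lra |].
  apply Rmult_le_compat_l; lra.
Qed.

(** With [Y = (2n + k + 1)^2], the part free of [k] is at most a small multiple of [Y], the
    numerator factor is at most about [Y], and each denominator factor is at least about [Y]. *)
Lemma wz_ratio_le_half :
  exists N : nat, forall n k, (N <= n)%nat -> (1 <= k)%nat ->
    (Cmod (wz_ratio a n k) <= / 2)%R.
Proof.
  (* From [64 |a|^2 <= (n + 1)^2] come [4 |a|^2 <= (n + 1)^2 / 16], hence the factor [17/16], and
     [|a|^2 <= Y / 64], hence [63/64] and [65/64]. The bound [17/32] then uses
     [2 (2n + 1) >= 2 (n + 1)]. *)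
  destruct (sq_INR_eventually_ge (64 * Cmod a ^ 2)) as [N HN].
  exists N; intros n k Hn Hk.
  specialize (HN (S n) ltac:(lia)).
  assert (Hrho : (Cmod ((natC n + 1) * ((natC n + 1) ^ 2 - 4 * a ^ 2)
      / (2 * (2 * natC n + 1))) <= 17 / 32 * INR (S n) ^ 2)%R).
  { rewrite Cmod_div by (apply Cmult_neq_0; [apply RtoC_2_neq_0 | apply odd_natC_neq_0]).
    rewrite Cmod_mult, <- natC_S; unfold natC.
    rewrite <- !RtoC_mult, <- RtoC_plus, <- RtoC_mult, !Cmod_R.
    pose proof (pos_INR n).
    assert (Hs : INR (S n) = (INR n + 1)%R) by apply S_INR.
    rewrite !Rabs_pos_eq by nra.
    apply Rle_div_l; [nra |].
    assert (T : (Cmod (RtoC (INR (S n)) ^ 2 - 4 * a ^ 2)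
      <= INR (S n) ^ 2 + 4 * Cmod a ^ 2)%R).
    { unfold Cminus; eapply Rle_trans; [apply Cmod_triangle |].
      rewrite Cmod_opp, Cmod_mult, !Cmod_pow, !Cmod_R, !Rabs_pos_eq by lra; lra. }
    set (x := INR (S n)) in *.
    assert (T' : (Cmod (RtoC x ^ 2 - 4 * a ^ 2) <= 17 / 16 * x ^ 2)%R) by lra.
    apply (Rle_trans _ (x * (17 / 16 * x ^ 2))).
    - apply Rmult_le_compat_l; lra.
    - assert (0 <= x ^ 2)%R by apply pow2_ge_0. nra. }
  unfold wz_ratio; set (rho := ((natC n + 1) * _ / _)%C) in *.
  pose proof (Cmod_sqdiff_pos (S (2 * n + k)) ltac:(lia)) as P1.
  pose proof (Cmod_sqdiff_pos (S (S (2 * n + k))) ltac:(lia)) as P2.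
  pose proof (Cmod_sqdiff_ge (S (2 * n + k))) as B1.
  pose proof (Cmod_sqdiff_ge (S (S (2 * n + k)))) as B2.
  pose proof (Cmod_sqdiff_le (n + k)) as B0.
  assert (L0 : (0 <= INR (n + k) <= INR (S (2 * n + k)))%R)
    by (split; [apply pos_INR | apply le_INR; lia]).
  (* Here [k >= 1] matters; it gives [(n + 1)^2 <= Y / 4] and turns [17/32] into [17/128]. *)
  assert (L1 : (0 <= 2 * INR (S n) <= INR (S (2 * n + k)))%R).
  { pose proof (pos_INR (S n)); split; [lra |].
    change 2%R with (INR 2); rewrite <- mult_INR; apply le_INR; lia. }
  assert (L2 : (INR (S (2 * n + k)) <= INR (S (S (2 * n + k))))%R)
    by (apply le_INR; lia).
  rewrite Cmod_div, !Cmod_mult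
    by (apply Cmult_neq_0; apply sqdiff_neq_0; lia).
  apply Rle_div_l; [now apply Rmult_lt_0_compat |].
  pose proof (Cmod_ge_0 rho) as R0; pose proof (Cmod_ge_0 (sqdiff a (n + k))) as D0.
  set (r := Cmod rho) in *; set (d0 := Cmod (sqdiff a (n + k))) in *.
  set (d1 := Cmod (sqdiff a (S (2 * n + k)))) in *.
  set (d2 := Cmod (sqdiff a (S (S (2 * n + k))))) in *.
  set (x := INR (S n)) in *; set (w := INR (n + k)) in *.
  set (y := INR (S (2 * n + k))) in *; set (z := INR (S (S (2 * n + k)))) in *.
  set (al := (Cmod a ^ 2)%R) in *.
  assert (X : (4 * x ^ 2 <= y ^ 2)%R) by nra.
  assert (W : (w ^ 2 <= y ^ 2)%R) by nra.
  assert (Z : (y ^ 2 <= z ^ 2)%R) by nra.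
  set (Y := (y ^ 2)%R) in *.
  assert (0 <= Y)%R by apply pow2_ge_0.
  assert (E1 : (63 / 64 * Y <= d1)%R) by lra.
  assert (E2 : (63 / 64 * Y <= d2)%R) by lra.
  assert (E0 : (d0 <= 65 / 64 * Y)%R) by lra.
  assert (ER : (r <= 17 / 128 * Y)%R) by lra.
  apply (Rle_trans _ ((17 / 128 * Y) * (65 / 64 * Y))).
  - now apply Rmult_le_compat.
  - apply (Rle_trans _ (/ 2 * ((63 / 64 * Y) * (63 / 64 * Y)))).
    + assert (0 <= Y * Y)%R by nra. lra.
    + apply Rmult_le_compat_l; [lra |]; apply Rmult_le_compat; lra.
Qed.

(** The majorant [B / (k (k + 1))] is chosen because its series telescopes to [B]. *)
Lemma wz_F_decay (n : nat) :
  exists B : R, forall k, (1 <= k)%nat ->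
    (Cmod (wz_F a n k) <= B / (INR k * (INR k + 1)))%R.
Proof.
  induction n as [| n [B IH]].
  - destruct sq_le_sqdiff as [M [HM HMb]].
    (* The factor [2] absorbs [k (k + 1) <= 2 k^2]. *)
    exists (2 * M)%R; intros k Hk.
    rewrite wz_F_0, Cmod_div, Cmod_1 by (try apply sqdiff_neq_0; exact Hk).
    specialize (HMb k Hk); pose proof (Cmod_sqdiff_pos k Hk).
    assert (1 <= INR k)%R by (apply (le_INR 1); exact Hk).
    apply Rle_div_l; [assumption |].
    unfold Rdiv; rewrite Rmult_assoc, (Rmult_comm (/ _)), <- Rmult_assoc.
    apply Rle_div_r; nra.
  - destruct (wz_ratio_bounded n) as [c [Hc Hcb]].
    exists (B * c)%R; intros k Hk.
    rewrite wz_F_ratio, Cmod_mult by exact Hk.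
    replace (B * c / (INR k * (INR k + 1)))%R
      with (B / (INR k * (INR k + 1)) * c)%R by (unfold Rdiv; ring).
    apply Rmult_le_compat; auto using Cmod_ge_0.
Qed.

(** Past the threshold [N] each step in [n] halves the bound uniformly in [k], so the majorant stays
    summable in [k]. *)
Lemma wz_F_geometric_decay :
  exists (N : nat) (B : R), forall p k, (1 <= k)%nat ->
    (Cmod (wz_F a (p + N) k) <= B * (/ 2) ^ p / (INR k * (INR k + 1)))%R.
Proof.
  destruct wz_ratio_le_half as [N HN].
  destruct (wz_F_decay N) as [B HB].
  exists N, B; intros p k Hk; induction p as [| p IH].
  - rewrite Rmult_1_r; now apply HB.
  - rewrite Nat.add_succ_l, wz_F_ratio, Cmod_mult by exact Hk.
    replace (B * (/ 2) ^ S p / (INR k * (INR k + 1)))%R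
      with (B * (/ 2) ^ p / (INR k * (INR k + 1)) * / 2)%R
      by (simpl; unfold Rdiv; ring).
    apply Rmult_le_compat; auto using Cmod_ge_0.
    apply HN; lia.
Qed.

(** * Decay of [G] in [k] *)

Lemma wz_Q_bounded (n : nat) :
  exists c : R, (0 <= c)%R /\
    forall k, (1 <= k)%nat -> (Cmod (wz_Q a n k) <= c * INR k ^ 3)%R.
Proof.
  set (q0 := (21 * natC n ^ 3 + 27 * natC n ^ 2 + 12 * natC n + 2
    - a ^ 2 * (9 * natC n + 5))%C).
  set (q1 := (28 * natC n ^ 2 + 22 * natC n + 4 - 2 * a ^ 2)%C).
  set (q2 := (13 * natC n + 5)%C).
  pose proof (Cmod_ge_0 q0); pose proof (Cmod_ge_0 q1); pose proof (Cmod_ge_0 q2).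
  exists (Cmod q0 + Cmod q1 + Cmod q2 + 2)%R; split; [lra |].
  intros k Hk.
  replace (wz_Q a n k)
    with (q0 + q1 * natC k + q2 * natC k ^ 2 + 2 * natC k ^ 3)%C
    by (unfold wz_Q, q0, q1, q2; ring).
  assert (Hk1 : (1 <= INR k)%R) by (apply (le_INR 1); exact Hk).
  eapply Rle_trans; [apply Cmod_triangle |].
  eapply Rle_trans; [apply Rplus_le_compat_r, Cmod_triangle |].
  eapply Rle_trans; [apply Rplus_le_compat_r, Rplus_le_compat_r, Cmod_triangle |].
  rewrite !Cmod_mult, !Cmod_pow; unfold natC.
  rewrite !Cmod_R, !Rabs_pos_eq by lra.
  set (x := INR k) in *.
  assert (1 <= x ^ 2)%R by nra.
  assert (x ^ 2 <= x ^ 3)%R by (simpl in *; nra).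
  assert (x <= x ^ 2)%R by nra.
  assert (Cmod q0 <= Cmod q0 * x ^ 3)%R by nra.
  assert (Cmod q1 * x <= Cmod q1 * x ^ 3)%R by (apply Rmult_le_compat_l; lra).
  assert (Cmod q2 * x ^ 2 <= Cmod q2 * x ^ 3)%R by (apply Rmult_le_compat_l; lra).
  lra.
Qed.

(** [F] is [O(k^-2)], [Q] is [O(k^3)], and the factor [sqdiff a (S (2 * n + k))] in the denominator
    is at least [k^2 / M]. *)
Lemma wz_G_decay (n : nat) :
  exists c : R, forall k, (1 <= k)%nat -> (Cmod (wz_G a n k) <= c / INR k)%R.
Proof.
  destruct (wz_F_decay n) as [B HB].
  destruct (wz_Q_bounded n) as [c [Hc HQ]].
  destruct sq_le_sqdiff as [M [HM HMb]].
  assert (H2 : (2 * (2 * natC n + 1))%C <> RtoC 0)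
    by (apply Cmult_neq_0; [apply RtoC_2_neq_0 | apply odd_natC_neq_0]).
  exists (B * c * M / Cmod (2 * (2 * natC n + 1)))%R; intros k Hk.
  specialize (HB k Hk); specialize (HQ k Hk).
  specialize (HMb (S (2 * n + k)) ltac:(lia)).
  pose proof (Cmod_sqdiff_pos (S (2 * n + k)) ltac:(lia)) as P1.
  pose proof (proj1 (Cmod_gt_0 _) H2) as P2.
  assert (L1 : (1 <= INR k)%R) by (apply (le_INR 1); exact Hk).
  assert (L2 : (INR k <= INR (S (2 * n + k)))%R) by (apply le_INR; lia).
  unfold wz_G.
  rewrite Cmod_div by (apply Cmult_neq_0; [exact H2 | apply sqdiff_neq_0; lia]).
  rewrite (Cmod_mult _ (sqdiff _ _)), Cmod_mult.
  set (f := Cmod (wz_F a n k)) in *; set (q := Cmod (wz_Q a n k)) in *.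
  set (e := Cmod (2 * _)) in *; set (d := Cmod (sqdiff _ _)) in *.
  set (x := INR k) in *; set (y := INR (S _)) in *.
  assert (F0 : (0 <= f)%R) by apply Cmod_ge_0.
  assert (F1 : (f * (x * (x + 1)) <= B)%R) by (apply Rle_div_r; nra).
  assert (F2 : (f * x ^ 2 <= B)%R) by nra.
  assert (D1 : (x ^ 2 <= M * d)%R) by nra.
  apply Rle_div_l; [now apply Rmult_lt_0_compat |].
  replace (B * c * M / e / x * (e * d))%R with (B * (c * (M * d)) / x)%R by (field; lra).
  apply (Rle_div_r (f * q)); [lra |].
  assert (Q0 : (0 <= q)%R) by apply Cmod_ge_0.
  apply (Rle_trans _ ((f * x ^ 2) * (c * x ^ 2))).
  - replace (f * x ^ 2 * (c * x ^ 2))%R with (f * (c * x ^ 3) * x)%R by ring.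
    apply Rmult_le_compat_r; [lra |]; apply Rmult_le_compat_l; assumption.
  - apply Rmult_le_compat; [pose proof (pow2_ge_0 x); nra | | exact F2 |].
    + pose proof (pow2_ge_0 x); nra.
    + now apply Rmult_le_compat_l.
Qed.

Lemma wz_G_lim (n : nat) :
  filterlim (fun k => wz_G a n (S k)) eventually (locally (zero : C_NormedModule)).
Proof.
  apply filterlim_norm_zero.
  destruct (wz_G_decay n) as [c Hc].
  apply (is_lim_seq_le_le (fun _ => 0%R) _ (fun k => c / INR (S k))%R (Finite 0)).
  - intros k; split; [apply norm_ge_0 |].
    exact (Hc (S k) ltac:(lia)).
  - apply is_lim_seq_const.
  - apply is_lim_seq_div_INR.
Qed.

(** * Summation over [k] and passage to the limit in [n] *)

Lemma wz_F_series_step (n : nat) (t : C) :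
  is_series (fun k => wz_F a n (S k)) t ->
  is_series (fun k => wz_F a (S n) (S k)) (t - accelerated_term a (S n))%C.
Proof.
  intros Ht.
  pose proof (is_series_telescope (V := C_NormedModule)
    (fun k => wz_G a n (S k)) (wz_G_lim n)) as HG.
  pose proof (is_series_minus _ _ _ _ Ht HG) as H.
  rewrite wz_G_1 in H.
  refine (is_series_ext _ _ _ _ H); intros k.
  change (wz_F a n (S k) - (wz_G a n (S k) - wz_G a n (S (S k)))
    = wz_F a (S n) (S k))%C.
  rewrite <- wz_pair by lia; ring.
Qed.

(** Identifies the remainder after [n + 1] accelerated terms as the sum of [F] at [n + 1]. *)
Lemma wz_F_series (s : C) :
  is_series (fun k => wz_F a 0 (S k)) s ->
  forall n, is_series (fun k => wz_F a (S n) (S k))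
    (s - sum_n (fun m => accelerated_term a (S m)) n)%C.
Proof.
  intros Hs n; induction n as [| n IHn].
  - rewrite sum_O; now apply wz_F_series_step.
  - rewrite sum_Sn.
    replace (s - _)%C with
      (s - sum_n (fun m => accelerated_term a (S m)) n - accelerated_term a (S (S n)))%C.
    + now apply wz_F_series_step.
    + change plus with Cplus; ring.
Qed.

Lemma accelerated_series (s : C) :
  is_series (fun k => wz_F a 0 (S k)) s ->
  is_series (fun n => accelerated_term a (S n)) s.
Proof.
  intros Hs.
  destruct wz_F_geometric_decay as [N [B HB]].
  (* The remainder after index [p + N] is the sum of [F] at [S p + N], hence the exponent [S p]. *)
  assert (Hrem : forall p,
    (Cmod (s - sum_n (fun m => accelerated_term a (S m)) (p + N))
     <= B * (/ 2) ^ S p)%R).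
  { intros p.
    apply (norm_series_le (V := C_NormedModule) _ _ _ _ (wz_F_series s Hs (p + N))
      (is_series_inv_pronic (B * (/ 2) ^ S p))).
    intros k; exact (HB (S p) (S k) ltac:(lia)). }
  apply filterlim_locally_ball_norm; intros eps.
  assert (Hlim : is_lim_seq (fun p => B * (/ 2) ^ S p)%R 0).
  { evar_last; [apply is_lim_seq_scal_l |].
    - apply (is_lim_seq_incr_1 (fun p => (/ 2) ^ p)%R).
      apply is_lim_seq_geom; rewrite Rabs_pos_eq; lra.
    - simpl; f_equal; ring. }
  apply is_lim_seq_spec in Hlim; destruct (Hlim eps) as [P HP].
  exists (P + N)%nat; intros n Hn.
  specialize (Hrem (n - N)%nat); specialize (HP (n - N)%nat ltac:(lia)).
  replace (n - N + N)%nat with n in Hrem by lia.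
  change (Cmod (sum_n (fun m => accelerated_term a (S m)) n - s) < eps)%R.
  rewrite <- Cmod_opp.
  replace (- (sum_n (fun m => accelerated_term a (S m)) n - s))%C
    with (s - sum_n (fun m => accelerated_term a (S m)) n)%C by ring.
  rewrite Rminus_0_r in HP; apply Rabs_def2 in HP; lra.
Qed.

End NonIntegral.

Theorem theorem2 (a : C) (ha : forall m : Z, m <> 0%Z -> a <> RtoC (IZR m)) :
  exists s : C,
    is_series1 (fun k => 1 / (natC k ^ 2 - a ^ 2))%C s /\
    is_series1 (accelerated_term a) s.
Proof.
  (* The common sum [s] exists by comparison with the telescoping majorant and completeness of the
     complex numbers. *)
  assert (Hex : ex_series (V := C_CompleteNormedModule) (fun k => wz_F a 0 (S k))).
  { destruct (wz_F_decay a ha 0) as [B HB].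
    apply (ex_series_le (V := C_CompleteNormedModule) _
      (fun k => B / (INR (S k) * (INR (S k) + 1)))%R).
    - intros k; exact (HB (S k) ltac:(lia)).
    - exists B; apply is_series_inv_pronic. }
  destruct Hex as [s Hs]; exists s; split.
  - refine (is_series_ext _ _ _ _ Hs); intros k.
    apply wz_F_0; [exact ha | lia].
  - now apply accelerated_series.
Qed.
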